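(* Let $n\ge4$ be even and let $f=a_1x_1^2+\dots+a_nx_n^2$ with $a_i\in\mathbb{F}_q^\times$ such that $(-1)^{n/2}a_1\cdots a_n$ is a square in $\mathbb{F}_q^\times$. Then for every integer $P\ge1$: $$N(P)=\frac{q^2-1}{q}Pq^{2P}+q^{2P}\quad\text{if }n=4,$$ $$N(P)=\frac{q^{n/2}-1}{q^{n/2-1}-q}\,q^{P(n-2)}-(q-1)\frac{q^{n/2-1}+1}{q^{n/2-1}-q}\,q^{\frac n2P}\quad\text{if }n\ge6.$$
   Context: $q$ is a power of an odd prime. $N(P)=\#\{\mathbf{x}\in\mathbb{F}_q[t]^n:\deg(x_i)<P\text{ for all }i,\ f(\mathbf{x})=0\}$ (with the convention $\deg 0=-\infty$, so $\mathbf{x}=\mathbf{0}$ is counted). *)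

(* Defs.v *)
From HB Require Import structures.
From mathcomp Require Import all_boot all_order all_algebra.
Set Implicit Arguments. Unset Strict Implicit. Unset Printing Implicit Defensive.
Import Order.TTheory GRing.Theory Num.Theory.
Local Open Scope ring_scope.

Definition poly_of_coefs (F : finFieldType) (P : nat) (c : {ffun 'I_P -> F})
  : {poly F} := \sum_(j < P) c j *: 'X^j.

Definition diag_form (F : finFieldType) (n : nat) (a : 'I_n -> F)
  (x : 'I_n -> {poly F}) : {poly F} :=
  \sum_(i < n) a i *: (x i ^+ 2).

(* N(P) = #{ x in F[t]^n : deg x_i < P for all i, f(x) = 0 }.
   The polynomials of degree < P (including 0) are in bijection with their
   coefficient vectors in F^P via poly_of_coefs, so we count those vectors. *)
Definition Ncount (F : finFieldType) (n : nat) (a : 'I_n -> F) (P : nat) : nat :=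
  #|[set x : {ffun 'I_n -> {ffun 'I_P -> F}} |
      diag_form a (fun i => poly_of_coefs (x i)) == 0]|.

(* Main.v *)
(* Over F_q the form is equivalent to u_1 v_1 + ... + u_m v_m with m = n/2, and the
   change of variables acts on polynomials of bounded degree.  Let L run over the
   linear functionals on polynomials of degree < 2P-1, and let K_L(c, d) be the space
   of polynomials u of degree < c with L (u t^j) = 0 for all j < d (the kernel of a
   Hankel matrix).  Counting the pairs (L, (u, v)) with L (sum u_i v_i) = 0 in two
   ways gives q^(2P-1) N(P) = q^(mP) sum_L #K_L(P, P)^m.
   The dimension D_L(c) of K_L(c, 2P-c) is convex in c, with D_L(0) = 0 and
   D_L(P) <= D_L(P-1) + 1, so its increments up to P are 0, ..., 0, 1, ..., 1.  Since
   sum_L q^D_L(c) is computed by exchanging sums, this shows that exactly q^(2c-2)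
   functionals have D_L(c) > 0, and then determines sum_L x^D_L(P) for every x. *)
Require Import Defs.
From HB Require Import structures.
From mathcomp Require Import all_boot all_order all_algebra.
From mathcomp Require Import finfield mxabelem zify ring.
Set Implicit Arguments. Unset Strict Implicit. Unset Printing Implicit Defensive.
Import Order.TTheory GRing.Theory Num.Theory.
Local Open Scope ring_scope.

(** * Counting solutions of separated equations by iterated convolution *)

Section Convolution.
Variable W : zmodType.

(** The number of tuples with [\sum phi_i (x_i) = w], defined by recursion so that leading summands
    can be replaced without touching the others. *)
Fixpoint conv (T : finType) (s : seq (T -> W)) (w : W) : nat :=
  if s is phi :: s' then (\sum_(x : T) conv s' (w - phi x))%N else (w == 0) : nat.

Lemma eq_conv_cons (T : finType) (phi : T -> W) (s s' : seq (T -> W)) (w : W) :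
  conv s =1 conv s' -> conv (phi :: s) w = conv (phi :: s') w.
Proof. by move=> e /=; apply: eq_bigr => x _; rewrite e. Qed.

Lemma conv_comp (S T : finType) (h : S -> T) (s : seq (T -> W)) (w : W) :
  bijective h -> conv [seq phi \o h | phi <- s] w = conv s w.
Proof.
move=> bh; elim: s w => [|phi s IHs] w //=.
rewrite (reindex h) /=; last exact: onW_bij.
by apply: eq_bigr => x _; rewrite IHs.
Qed.

Lemma card_sum_eq (T : finType) (n : nat) (phi : 'I_n -> T -> W) (w : W) :
  #|[set x : {ffun 'I_n -> T} | \sum_i phi i (x i) == w]|
    = conv [seq phi i | i <- enum 'I_n] w.
Proof.
elim: n phi w => [|n IHn] phi w.
  rewrite enum_ord0 /=.
  have -> : [set x : {ffun 'I_0 -> T} | \sum_i phi i (x i) == w]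
          = if w == 0 then setT else set0.
    by apply/setP=> x; rewrite inE big_ord0 eq_sym; case: (w == 0); rewrite inE.
  case: eqP => _; last by rewrite cards0.
  by rewrite cardsT card_ffun card_ord expn0.
rewrite enum_ordSl /= -map_comp.
rewrite -sum1_card (partition_big (fun x : {ffun _} => x ord0) xpredT) //=.
apply: eq_bigr => y _; rewrite -IHn -sum1_card.
pose cons (x : {ffun 'I_n -> T}) : {ffun 'I_n.+1 -> T} :=
  [ffun i => oapp x y (unlift ord0 i)].
have cons0 x : cons x ord0 = y by rewrite ffunE unlift_none.
have consS x i : cons x (lift ord0 i) = x i by rewrite ffunE liftK.
rewrite (reindex_onto cons (fun z => [ffun i => z (lift ord0 i)])) /=; last first.
  move=> z /andP[_ /eqP zy]; apply/ffunP=> i; rewrite ffunE.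
  by case: unliftP => [j|] -> //=; rewrite ffunE.
apply: eq_bigl => x; rewrite !inE cons0 eqxx andbT.
have -> : [ffun i => cons x (lift ord0 i)] == x.
  by apply/eqP/ffunP=> i; rewrite ffunE consS.
rewrite andbT big_ord_recl cons0 -subr_eq0 -[RHS]subr_eq0.
rewrite opprB addrA [y in _ = (y - w == 0)]addrC.
by congr (_ + _ - w == 0); apply: eq_bigr => i _; rewrite consS.
Qed.

End Convolution.

(** Besides bounding the number of squares, this stands in for rank-nullity when dimensions are
    compared through powers of [q]. *)
Lemma card_le_fiber (S T : finType) (A : {set S}) (B : {set T}) (f : S -> T)
    (k : nat) :
  {in A, forall x, f x \in B} ->
  {in A, forall x0, (#|[set x in A | f x == f x0]| <= k)%N} ->
  (#|A| <= #|B| * k)%N.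
Proof.
move=> fB fk; rewrite -sum1_card (partition_big f (mem B)) //=.
rewrite -sum_nat_const; apply: leq_sum => y _.
rewrite sum1dep_card.
case: (pickP [pred x in A | f x == y]) => [x0 /andP[Ax0 /eqP <-]|A0].
  by apply: leq_trans (fk x0 Ax0).
by rewrite (eq_card0 (A := [set _ | _])) // => x; have:= A0 x; rewrite !inE.
Qed.

(** * Reduction of the diagonal form to a sum of hyperbolic planes *)

Section SplitForm.
Variable F : finFieldType.
Hypothesis odd_card : odd #|F|.

(** Translation by 1 permutes [F], so comparing sums over all elements gives [#|F| = 0] in [F]; if 2
    vanished, oddness would turn this into [1 = 0]. *)
Lemma two_neq0 : 2%:R != 0 :> F.
Proof.
apply/eqP=> two0; suff /eqP : #|F|%:R = 0 :> F.
  by rewrite -(odd_double_half #|F|) odd_card -mul2n natrD natrM two0 mul0r addr0 oner_eq0.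
apply: (addrI (\sum_(x : F) x)); rewrite addr0 -sumr_const -big_split /=.
by rewrite [RHS](reindex_inj (addIr 1)).
Qed.

(** Squaring is at most two-to-one, and parity excludes equality. *)
Lemma card_squares : (#|F| < 2 * #|[set x ^+ 2 | x : F]|)%N.
Proof.
rewrite ltn_neqAle; apply/andP; split.
  by apply: contraTneq odd_card => ->; rewrite oddM.
rewrite mulnC -cardsT; apply: (card_le_fiber (f := fun x : F => x ^+ 2)).
  by move=> x _; apply: imset_f.
move=> x0 _; apply: leq_trans (subset_leq_card (_ : _ \subset [set x0; - x0])) _.
  by apply/subsetP => x; rewrite !inE eqf_sqr.
by rewrite cards2; case: (_ != _).
Qed.

(* Pigeonhole: the sets [a x^2] and [c - b y^2] each fill more than half of [F]. *)
Lemma binary_form_universal (a b c : F) : a != 0 -> b != 0 ->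
  exists e f : F, a * e ^+ 2 + b * f ^+ 2 = c.
Proof.
move=> a0 b0; pose Sq := [set x ^+ 2 | x : F].
pose A := [set a * x | x in Sq]; pose B := [set c - b * x | x in Sq].
have cA : #|A| = #|Sq| by apply: card_imset; apply: mulfI.
have cB : #|B| = #|Sq|.
  by apply: card_imset => x y /addrI/oppr_inj/(mulfI b0).
have : (0 < #|A :&: B|)%N.
  have := cardsUI A B; have : (#|A :|: B| <= #|F|)%N := max_card _.
  by have := card_squares; rewrite cA cB -/Sq => lt le eU; lia.
case/card_gt0P => z; rewrite inE => /andP[].
case/imsetP=> _ /imsetP[e _ ->] -> /imsetP[_ /imsetP[f _ ->] /eqP].
by rewrite eq_sym subr_eq => /eqP->; exists e, f.
Qed.

Variable P : nat.
Local Notation V := 'rV[F]_P.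

Definition sqform (a : F) (x : V) : {poly F} := a *: rVpoly x ^+ 2.

Definition hypform (z : V * V) : {poly F} := rVpoly z.1 * rVpoly z.2.

(* With [c = a e^2 + b f^2], the invertible substitution
   [(x, y) -> (e x - b f y, f x + a e y)] turns <a, b> into <c, abc>. *)
Lemma sqform_pair (a b c : F) (G : {poly F} -> nat) :
  a != 0 -> b != 0 -> c != 0 ->
  (\sum_x \sum_y G (sqform a x + sqform b y)%R =
   \sum_x \sum_y G (sqform c x + sqform (a * b * c) y)%R)%N.
Proof.
move=> a0 b0 c0; have [e [f cE]] := binary_form_universal c a0 b0.
rewrite !pair_big /=.
pose h (z : V * V) := (e *: z.1 - (b * f) *: z.2, f *: z.1 + (a * e) *: z.2).
rewrite (reindex_inj (h := h)) /=; last first.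
  move=> [x y] [x' y'] [/= E1 E2].
  (* The substitution has determinant [a e^2 + b f^2 = c]; its adjugate recovers [c x] and [c y]. *)
  have Ex : c *: x = c *: x'.
    transitivity ((a * e) *: (e *: x - (b * f) *: y)
                  + (b * f) *: (f *: x + (a * e) *: y)).
      rewrite -cE; apply/rowP=> i; rewrite !mxE; ring.
    rewrite E1 E2 -cE; apply/rowP=> i; rewrite !mxE; ring.
  have Ey : c *: y = c *: y'.
    transitivity (e *: (f *: x + (a * e) *: y) - f *: (e *: x - (b * f) *: y)).
      rewrite -cE; apply/rowP=> i; rewrite !mxE; ring.
    rewrite E1 E2 -cE; apply/rowP=> i; rewrite !mxE; ring.
  by rewrite (scalerI c0 Ex) (scalerI c0 Ey).
apply: eq_bigr => -[x y] _ /=; congr G.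
rewrite /sqform !linearD !linearN !linearZ /= -cE -!mul_polyC !(rmorphD, rmorphM, rmorphXn).
rewrite /=; ring.
Qed.

(* When [e^2 = -ab], one has [a x^2 + b y^2 = (a x - e y) (x + (e / a) y)]. *)
Lemma sqform_hypform (a b e : F) (G : {poly F} -> nat) :
  a != 0 -> e != 0 -> e ^+ 2 = - (a * b) ->
  (\sum_x \sum_y G (sqform a x + sqform b y)%R = \sum_z G (hypform z))%N.
Proof.
move=> a0 e0 eE; rewrite pair_big /=.
pose h (z : V * V) := (a *: z.1 - e *: z.2, z.1 + (e / a) *: z.2).
(* Combining the two coordinates recovers only [2 a x] and [2 e y], so injectivity rests on odd
   characteristic. *)
have t0 : 2%:R * a != 0 by rewrite mulf_neq0 ?two_neq0.
have s0 : 2%:R * e != 0 by rewrite mulf_neq0 ?two_neq0.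
rewrite [RHS](reindex_inj (h := h)) /=; last first.
  move=> [x y] [x' y'] [/= E1 E2].
  have Ex : (2%:R * a) *: x = (2%:R * a) *: x'.
    transitivity ((a *: x - e *: y) + a *: (x + (e / a) *: y)).
      by apply/rowP=> i; rewrite !mxE; field.
    by rewrite E1 E2; apply/rowP=> i; rewrite !mxE; field.
  have Ey : (2%:R * e) *: y = (2%:R * e) *: y'.
    transitivity (a *: (x + (e / a) *: y) - (a *: x - e *: y)).
      by apply/rowP=> i; rewrite !mxE; field.
    by rewrite E1 E2; apply/rowP=> i; rewrite !mxE; field.
  by rewrite (scalerI t0 Ex) (scalerI s0 Ey).
apply: eq_bigr => -[x y] _ /=; congr G.
pose k := e / a.
have -> : b = - (k * a * k) by rewrite divfK // mulrA -expr2 eE; field.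
rewrite /sqform /hypform /= -/k -[e](divfK a0) -/k.
rewrite !linearD !linearN !linearZ /= -!mul_polyC !(rmorphN, rmorphM) /=; ring.
Qed.

(** Induction peeling off hyperbolic planes: <a, b, c> becomes <a, -a, -abc>, the pair <a, -a> is
    hyperbolic, and the discriminant condition passes to the rest with the same [e]. *)
Lemma conv_split_form (s : seq F) (m : nat) (e : F) (w : {poly F}) :
  size s = m.*2 -> all (fun a => a != 0) s -> e != 0 ->
  e ^+ 2 = (-1) ^+ m * \prod_(a <- s) a ->
  conv [seq sqform a | a <- s] w = conv (nseq m hypform) w.
Proof.
have convE a b t v : conv [seq sqform x | x <- [:: a, b & t]] v
    = (\sum_x \sum_y conv [seq sqform x | x <- t] (v - (sqform a x + sqform b y))%R)%N.
  by apply: eq_bigr => x _; apply: eq_bigr => y _; rewrite opprD addrA.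
elim: m s e w => [|m IHm] [|a [|b s]] // e w [sz] /and3P[a0 b0 nz] e0; rewrite !big_cons => eE.
case: s => [|c s] in sz nz eE *.
  case: m sz {IHm} => // _ in eE *.
  rewrite convE.
  rewrite (sqform_hypform (e := e) (fun v => conv _ (w - v)%R)) //.
  by rewrite eE big_nil; ring.
case: m => [//|m] in sz eE IHm *.
have /= /andP[c0 ns] := nz.
pose d := b * c * (- a).
have d0 : d != 0 by rewrite !mulf_neq0 ?oppr_eq0.
transitivity (conv [seq sqform x | x <- [:: a, - a, d & s]] w).
  apply: (@eq_conv_cons _ _ (sqform a) [seq sqform x | x <- [:: b, c & s]]
    [seq sqform x | x <- [:: - a, d & s]]) => v; rewrite !convE.
  by rewrite (sqform_pair (fun x => conv _ (v - x)) b0 c0 (c := - a)) ?oppr_eq0.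
rewrite convE (sqform_hypform (e := a) (fun v => conv _ (w - v)%R)) //; last by ring.
apply: eq_bigr => z _; apply: (IHm _ e) => //=.
  by rewrite d0.
by rewrite eE !big_cons !exprS /d; ring.
Qed.

End SplitForm.

(** * Kernels of Hankel matrices and the convexity of their dimensions *)

Section Annihilator.
Variable F : finFieldType.
Local Notation q := #|F|.
Implicit Type L : {scalar {poly F}}.

Definition annih (L : {poly F} -> F) (c d : nat) : {set 'rV[F]_c} :=
  [set u | [forall j : 'I_d, L (rVpoly u * 'X^j) == 0]].

(** The dimension of K_L(c, d), as the left kernel of the Hankel matrix of [L]; thus D_L(c) is
    [nullity L c (2P - c)]. *)
Definition nullity (L : {poly F} -> F) (c d : nat) : nat :=
  \rank (kermx (\matrix_(i < c, j < d) L ('X^i * 'X^j))).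

Lemma annihP (L : {poly F} -> F) (c d : nat) (u : 'rV[F]_c) :
  reflect (forall j, (j < d)%N -> L (rVpoly u * 'X^j) = 0) (u \in annih L c d).
Proof.
rewrite inE; apply: (iffP forallP) => [H j jd|H j]; last by rewrite H.
exact/eqP/(H (Ordinal jd)).
Qed.

Lemma annih_polyP (L : {poly F} -> F) (c d : nat) (p : {poly F}) :
  (size p <= c)%N ->
  reflect (forall j, (j < d)%N -> L (p * 'X^j) = 0) (poly_rV p \in annih L c d).
Proof.
by move=> sp; apply: (iffP (annihP _ _ _)) => H j jd; have := H j jd; rewrite poly_rV_K.
Qed.

Lemma size_rVpoly (c : nat) (u : 'rV[F]_c) : (size (rVpoly u) <= c)%N.
Proof. exact: size_poly. Qed.

Lemma rVpoly_sum (c : nat) (u : 'rV[F]_c) : rVpoly u = \sum_(i < c) u 0 i *: 'X^i.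
Proof.
by rewrite [LHS]poly_def; apply: eq_bigr => i _; rewrite valK.
Qed.

Lemma card_annih L (c d : nat) : #|annih L c d| = (q ^ nullity L c d)%N.
Proof.
rewrite -card_rowg; apply: eq_card => u; rewrite mem_rowg sub_kermx.
have uE j : (u *m \matrix_(i < c, j < d) L ('X^i * 'X^j)) 0 j = L (rVpoly u * 'X^j).
  rewrite mxE rVpoly_sum mulr_suml linear_sum; apply: eq_bigr => i _.
  by rewrite mxE -scalerAl linearZ.
apply/annihP/eqP => [H|H j jd]; first by apply/rowP=> j; rewrite uE H ?mxE.
by rewrite -(uE (Ordinal jd)) H mxE.
Qed.

(* [(u, v) -> u + t v] maps [K(c+1,d+1)^2] to [K(c+2,d)], and two points of a
   fibre differ by [(- t w, w)] with [w] in [K(c,d+2)]. *)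
Lemma nullity_convex L (c d : nat) :
  ((nullity L c.+1 d.+1).*2 <= nullity L c.+2 d + nullity L c d.+2)%N.
Proof.
have q1 : (1 < q)%N by exact: finNzRing_gt1.
rewrite -(leq_exp2l _ _ q1) -addnn !expnD -!card_annih -cardsX.
pose s (z : 'rV[F]_c.+1 * 'rV[F]_c.+1) := rVpoly z.1 + rVpoly z.2 * 'X.
have sz z : (size (s z) <= c.+2)%N.
  apply: leq_trans (size_polyD _ _) _; rewrite geq_max.
  rewrite (leq_trans (size_rVpoly _)) //=.
  by apply: leq_trans (size_polyMleq _ _) _; rewrite size_polyX addn2 /= ltnS size_rVpoly.
apply: (card_le_fiber (f := fun z => poly_rV (s z))) => [[u v]|[u0 v0]].
  rewrite inE => /andP[/annihP/= Ku /annihP/= Kv]; apply/annih_polyP => // j jd.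
  by rewrite mulrDl linearD /= Ku 1?ltnW // -mulrA -exprS Kv ?addr0.
rewrite inE => /andP[/annihP/= Ku0 /annihP/= Kv0].
pose g (z : 'rV[F]_c.+1 * 'rV[F]_c.+1) : 'rV[F]_c := poly_rV (rVpoly z.2 - rVpoly v0).
set B := [set z in _ | _].
have Bp z : z \in B -> (rVpoly z.2 - rVpoly v0) * 'X = rVpoly u0 - rVpoly z.1.
  rewrite inE => /andP[_ /eqP /(congr1 rVpoly)]; rewrite !poly_rV_K // /s /=.
  by move/eqP; rewrite addrC -subr_eq => /eqP E; rewrite mulrBl -E; ring.
(* Multiplication by [t] raises the degree by exactly one, and the right side of [Bp] has size at
   most [c.+1]. *)
have Bs z : z \in B -> (size (rVpoly z.2 - rVpoly v0)%R <= c)%N.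
  move/Bp => E; have [->|nz] := eqVneq (rVpoly z.2 - rVpoly v0) 0; first by rewrite size_poly0.
  rewrite -ltnS -size_mulX // E; apply: leq_trans (size_polyD _ _) _.
  by rewrite size_polyN geq_max !size_rVpoly.
rewrite -(card_in_imset (f := g) (D := B)); last first.
  move=> [u v] [u' v'] Bz Bz' /(congr1 rVpoly); rewrite !poly_rV_K ?Bs //=.
  move=> E; have := Bp _ Bz; have := Bp _ Bz'; rewrite /= E => -> /addrI/oppr_inj Eu.
  by move/addIr: E => /(can_inj rVpolyK)->; rewrite (can_inj rVpolyK Eu).
apply/subset_leq_card/subsetP => _ /imsetP[z Bz ->].
apply/annih_polyP => [|j]; first exact: Bs.
have := Bz; rewrite !inE => /andP[/andP[/forallP Kz1 /forallP Kz2] _].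
(* For the new exponent [j = d.+1], one factor [t] is absorbed by [t w = u0 - u], and [L] kills the
   result against [t^d]. *)
rewrite ltnS leq_eqVlt => /predU1P[->|jd].
  rewrite exprS mulrA Bp // mulrBl linearB /= Ku0 //.
  by rewrite (eqP (Kz1 ord_max)) subrr.
by rewrite mulrBl linearB /= Kv0 // (eqP (Kz2 (Ordinal jd))) subrr.
Qed.

(* If some [g] in [K(c+1,c+1)] has degree [c], then [L (g t w) = 0] gives
   [L (t^(c+1) w) = 0] for every [w] in [K(c+1,c+1)] of degree below [c]; so in all
   cases [K(c,c+2)] contains the kernel in [K(c+1,c+1)] of one linear functional. *)
Lemma nullity_step L (c : nat) :
  (nullity L c.+1 c.+1 <= (nullity L c c.+2).+1)%N.
Proof.
have q1 : (1 < q)%N by exact: finNzRing_gt1.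
rewrite -(leq_exp2l _ _ q1) expnS -!card_annih.
(* An additive map to [F] whose kernel in K(c+1,c+1) lies in K(c,c+2) suffices: it has at most [q]
   fibres, and subtracting a point embeds each into that kernel. *)
suff [f [fB fK]] : exists f : 'rV[F]_c.+1 -> F, {morph f : x y / x - y} /\
    forall w, w \in annih L c.+1 c.+1 -> f w = 0 ->
      (size (rVpoly w) <= c)%N /\ L (rVpoly w * 'X^(c.+1)) = 0.
  rewrite -cardsT; apply: (card_le_fiber (f := f)) => [//|u0 Ku0].
  set B := [set z in _ | _].
  have Bd z : z \in B ->
      (size (rVpoly (z - u0)) <= c)%N /\ poly_rV (rVpoly (z - u0)) \in annih L c c.+2.
    rewrite inE => /andP[Kz /eqP fz].
    have Kd : z - u0 \in annih L c.+1 c.+1.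
      apply/annihP => j jd; rewrite linearB mulrBl linearB /=.
      by rewrite (annihP _ _ _ Kz) // (annihP _ _ _ Ku0) // subrr.
    have [|sd Ld] := fK _ Kd; first by rewrite fB fz subrr.
    split=> //; apply/annih_polyP => // j; rewrite ltnS leq_eqVlt => /predU1P[->//|jd].
    exact: (annihP _ _ _ Kd).
  rewrite -(card_in_imset (f := fun z => poly_rV (rVpoly (z - u0)) : 'rV_c) (D := B)).
    by apply/subset_leq_card/subsetP => _ /imsetP[z Bz ->]; have [] := Bd z Bz.
  move=> z z' /Bd[sz _] /Bd[sz' _] /(congr1 rVpoly); rewrite !poly_rV_K //.
  by move/(can_inj rVpolyK)/addIr.
have szc (w : 'rV[F]_c.+1) : w 0 ord_max = 0 -> (size (rVpoly w) <= c)%N.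
  move=> w0; apply/leq_sizeP => j; rewrite leq_eqVlt => /predU1P[<-|cj].
    by rewrite -[c]/(nat_of_ord (@ord_max c)) coef_rVpoly_ord.
  by apply: (leq_sizeP _ _ (size_rVpoly w)).
case: (pickP [pred g in annih L c.+1 c.+1 | g 0 ord_max != 0]) => [g|K0]; last first.
  exists (fun w => L (rVpoly w * 'X^(c.+1))); split=> [x y|w Kw ->].
    by rewrite linearB mulrBl linearB.
  by split=> //; apply: szc; have := K0 w; rewrite /= Kw => /negbFE/eqP.
rewrite /= => /andP[/annihP Kg g0]; exists (fun w => w 0 ord_max).
split=> [x y|w Kw w0]; first by rewrite !mxE.
split; first exact: szc.
have sw := szc _ w0.
(* [L (g t w)] is evaluated twice. Expanding [w], every term vanishes since [w] has degree below
   [c]; expanding [g] isolates its top coefficient times [L (t^(c+1) w)]. *)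
have : L (rVpoly g * (rVpoly w * 'X)) = 0.
  rewrite [rVpoly w]rVpoly_sum mulr_suml mulr_sumr linear_sum big1 // => i _.
  have [->|ni] := eqVneq i ord_max; first by rewrite w0 scale0r mul0r mulr0 linear0.
  rewrite -scalerAl -exprSr -scalerAr linearZ /= Kg ?mulr0 //.
  by have := ltn_ord i; move: ni; rewrite -val_eqE /=; lia.
have shift i : 'X^i * (rVpoly w * 'X) = rVpoly w * 'X^(i.+1) by rewrite mulrCA -exprSr.
rewrite [rVpoly g]rVpoly_sum mulr_suml linear_sum big_ord_recr big1 /= => [|i _].
  by rewrite add0r -scalerAl linearZ /= shift => /eqP; rewrite mulf_eq0 (negPf g0) => /eqP.
rewrite -scalerAl linearZ /= shift (annihP _ _ _ Kw) ?mulr0 //.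
by rewrite ltnS.
Qed.

Lemma nullity0 L (d : nat) : nullity L 0 d = 0%N.
Proof. by apply/eqP; rewrite -leqn0 rank_leq_row. Qed.

(** The increments are nondecreasing and the last is at most 1. A nonpositive increment makes all
    earlier ones nonpositive, so [D] has stayed at 0. The truncated predecessor covers both cases:
    increment 1, or both values 0. *)
Lemma convex_slope01 (D : nat -> nat) (p : nat) :
  D 0 = 0%N -> (forall k, (k < p)%N -> ((D k.+1).*2 <= D k.+2 + D k)%N) ->
  (D p.+1 <= (D p).+1)%N ->
  forall c, (c <= p)%N -> D c = (D c.+1).-1.
Proof.
move=> D0 Dc Dp.
have flat c : (c <= p)%N -> (D c.+1 <= D c)%N -> (D c + D c.+1 = 0)%N.
  elim: c => [_|c IHc cp le]; first by rewrite D0; lia.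
  have le' : (D c.+1 <= D c)%N by have := Dc c cp; lia.
  by have := IHc (ltnW cp) le'; lia.
have slope c : (c <= p)%N -> (D c.+1 <= (D c).+1)%N.
  move=> cp; have [k pE] : exists k, p = (c + k)%N by exists (p - c)%N; rewrite subnKC.
  elim: k c pE {cp} => [|k IHk] c pE; first by move: Dp; rewrite pE addn0.
  have cp : (c < p)%N by rewrite pE addnS ltnS leq_addr.
  have := Dc c cp; have := IHk c.+1; rewrite pE addSnnS => /(_ erefl); lia.
move=> c cp; have := slope c cp; have [/(flat c cp)|] := leqP (D c.+1) (D c); lia.
Qed.

(** Here P is [p.+1] and 2P is [p.*2.+2]; the last increment compares the formats P by P and P-1 by
    P+1, as in [nullity_step]. *)
Lemma nullity_pred L (p c : nat) : (c <= p)%N ->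
  nullity L c (p.*2.+2 - c) = (nullity L c.+1 (p.*2.+2 - c.+1)).-1.
Proof.
apply: (convex_slope01 (D := fun c => nullity L c (p.*2.+2 - c))) => [|k kp|].
- exact: nullity0.
- have := nullity_convex L k (p.*2 - k).
  have -> : (p.*2 - k).+2 = (p.*2.+2 - k)%N by lia.
  by have -> : (p.*2 - k).+1 = (p.*2.+2 - k.+1)%N by lia.
have -> : (p.*2.+2 - p.+1 = p.+1)%N by lia.
have -> : (p.*2.+2 - p = p.+2)%N by lia.
exact: nullity_step.
Qed.
End Annihilator.

(** * Double counting over linear functionals *)

Section Counting.
Variable F : finFieldType.
Local Notation q := #|F|.

(** As [al] varies, this runs over all functionals on polynomials of degree below [N], extended by
    zero on higher powers of [t]. *)
Definition coefform (N : nat) (al : 'rV[F]_N) (p : {poly F}) : F :=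
  \sum_(k < N) al 0 k * p`_k.

Fact coefform_is_scalar (N : nat) (al : 'rV[F]_N) : scalar (coefform al).
Proof.
move=> b p p'; rewrite /coefform mulr_sumr -big_split /=.
by apply: eq_bigr => k _; rewrite coefD coefZ; ring.
Qed.

HB.instance Definition _ (N : nat) (al : 'rV[F]_N) :=
  GRing.isLinear.Build F {poly F} F *%R (coefform al) (coefform_is_scalar al).

(** The fibres of a nonzero functional are translates of each other along [x1]. *)
Lemma card_scalar_fiber (n : nat) (f : 'rV[F]_n -> F) (x1 : 'rV[F]_n) (c : F) :
  scalar f -> f x1 != 0 -> (q * #|[set x | f x == c]| = q ^ n)%N.
Proof.
move=> lf f1.
have eqc c' : #|[set x | f x == c']| = #|[set x | f x == c]|.
  rewrite -(card_imset _ (addrI (((c - c') / f x1) *: x1))).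
  apply: eq_card => x; rewrite inE; apply/imsetP/eqP => [[y]|fx].
    by rewrite inE => /eqP fy ->; rewrite lf fy divfK // subrK.
  exists (x - ((c - c') / f x1) *: x1); last by rewrite addrC subrK.
  by rewrite inE addrC -scaleNr lf fx mulNr divfK // opprB subrK.
have -> : (q ^ n = #|'rV[F]_n|)%N by rewrite card_mx mul1n.
rewrite -[RHS]sum1_card [RHS](partition_big f xpredT) //= -sum_nat_const.
by apply: eq_big => // c' _; rewrite sum1dep_card eqc.
Qed.

(** A nonzero [w] cuts out a hyperplane of functionals, while [w = 0] imposes no condition; this is
    how zeros of the form are detected. *)
Lemma card_coefform_eq0 (N : nat) (w : {poly F}) : (size w <= N)%N ->
  (q * #|[set al : 'rV[F]_N | coefform al w == 0%R]|
     = q ^ N + (w == 0%R) * (q.-1 * q ^ N))%N.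
Proof.
move=> sw; have [->|w0] := eqVneq w 0.
  have -> : [set al : 'rV[F]_N | coefform al 0 == 0] = setT.
    by apply/setP => al; rewrite !inE linear0 eqxx.
  rewrite cardsT card_mx mul1n mul1n -mulSn prednK //.
  exact: ltnW (finNzRing_gt1 F).
rewrite addn0; have sw0 : (0 < size w)%N by rewrite size_poly_gt0.
have lw : ((size w).-1 < N)%N by rewrite prednK.
apply: (card_scalar_fiber (x1 := delta_mx 0 (Ordinal lw))) => [b x y|].
  rewrite /coefform mulr_sumr -big_split /=.
  by apply: eq_bigr => k _; rewrite !mxE; ring.
rewrite /coefform (bigD1 (Ordinal lw)) //= big1 => [|k kn].
  by rewrite mxE !eqxx mul1r addr0 -lead_coefE lead_coef_eq0.
by rewrite mxE (negPf kn) andbF mul0r.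
Qed.

(** For fixed [u], the functional [v -> L (u v)] is zero exactly when [u] lies in K_L(P, P), and is
    equidistributed otherwise. Negative terms are moved across to stay in [nat]. *)
Lemma card_hypform_fiber (P : nat) (L : {scalar {poly F}}) (c : F) :
  (q * #|[set z : 'rV[F]_P * 'rV[F]_P | L (hypform z) == c]| + q ^ P * #|annih L P P|
     = q ^ P * q ^ P + (c == 0%R) * q * (q ^ P * #|annih L P P|))%N.
Proof.
have fib (u : 'rV[F]_P) :
   (q * #|[set v : 'rV[F]_P | L (rVpoly u * rVpoly v)%R == c]| + (u \in annih L P P) * q ^ P
   = q ^ P + (u \in annih L P P) * ((c == 0%R) * q * q ^ P))%N.
  have mulL (v : 'rV[F]_P) :
      L (rVpoly u * rVpoly v) = \sum_(i < P) v 0 i * L (rVpoly u * 'X^i).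
    rewrite [rVpoly v]rVpoly_sum mulr_sumr linear_sum.
    by apply: eq_bigr => i _; rewrite -scalerAr linearZ.
  case: (boolP (u \in annih L P P)) => [/annihP Ku|].
    rewrite !mul1n addnC; congr addn; rewrite -mulnA mulnCA; congr muln.
    have -> : [set v : 'rV[F]_P | L (rVpoly u * rVpoly v) == c]
              = if c == 0 then setT else set0.
      apply/setP => v; rewrite inE mulL big1 => [|i _]; last by rewrite Ku ?mulr0.
      by rewrite eq_sym; case: (c == 0); rewrite inE.
    by case: (c == 0); rewrite ?cards0 // cardsT card_mx !mul1n.
  rewrite inE negb_forall => /existsP[j Lj]; rewrite !addn0.
  apply: (card_scalar_fiber (x1 := delta_mx 0 j)) => [b x y|].
    by rewrite linearD linearZ /= mulrDr linearD -scalerAr linearZ.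
  by rewrite rVpoly_delta.
have -> : #|[set z : 'rV[F]_P * 'rV[F]_P | L (hypform z) == c]| =
    (\sum_(u : 'rV[F]_P) #|[set v : 'rV[F]_P | L (rVpoly u * rVpoly v)%R == c]|)%N.
  rewrite -sum1dep_card -(pair_big_dep xpredT (fun u v => L (hypform (u, v)) == c) (fun _ _ => 1%N)) /=.
  by apply: eq_bigr => u _; rewrite sum1dep_card.
have cK : (\sum_u (u \in annih L P P) = #|annih L P P|)%N.
  by rewrite -[RHS]sum1_card [RHS]big_mkcond /=; apply: eq_bigr => u _; case: (_ \in _).
have cV : (\sum_(u : 'rV[F]_P) 1 = q ^ P)%N by rewrite sum1_card card_mx mul1n.
rewrite big_distrr -cK big_distrr -big_split /=.
rewrite (eq_bigr _ (fun u _ => etrans (congr1 (addn _) (mulnC _ _)) (fib u))).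
rewrite big_split /= sum_nat_const card_mx mul1n -big_distrl /=.
by congr addn; rewrite -big_distrr /=; ring.
Qed.

(** The values of [L (u v)] consist of a uniform part of mass [q^(2P) - Y] and a mass [Y] at 0.
    Convolving with a uniform part gives a uniform part, so total mass and point mass are simply
    raised to the power [m]. *)
Lemma conv_scalar_hypform (P m : nat) (L : {scalar {poly F}}) (c : F) :
  let Y := (q ^ P * #|annih L P P|)%N in
  (q * conv (nseq m (fun z : 'rV[F]_P * 'rV[F]_P => L (hypform z))) c + Y ^ m
     = (q ^ P * q ^ P) ^ m + (c == 0%R) * q * Y ^ m)%N.
Proof.
move=> Y; elim: m c => [|m IHm] c /=.
  by rewrite !expn0 muln1 addnC mulnC.
have cZ : (q ^ P * q ^ P)%N = #|{: 'rV[F]_P * 'rV[F]_P}| by rewrite card_prod card_mx mul1n.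
have sumc : (\sum_(z : 'rV[F]_P * 'rV[F]_P) ((c - L (hypform z))%R == 0%R)
    = #|[set z : 'rV[F]_P * 'rV[F]_P | L (hypform z) == c]|)%N.
  rewrite -sum1dep_card [RHS]big_mkcond /=; apply: eq_bigr => z _.
  by rewrite subr_eq0 eq_sym; case: (_ == _).
have H1 := card_hypform_fiber P L c; rewrite -sumc -/Y in H1.
have : (\sum_(z : 'rV[F]_P * 'rV[F]_P)
    (q * conv (nseq m (fun z : 'rV[F]_P * 'rV[F]_P => L (hypform z))) (c - L (hypform z))%R + Y ^ m)
  = \sum_(z : 'rV[F]_P * 'rV[F]_P)
    ((q ^ P * q ^ P) ^ m + ((c - L (hypform z))%R == 0%R) * q * Y ^ m))%N.
  by apply: eq_bigr => z _; apply: IHm.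
rewrite !big_split /= !sum_nat_const -!big_distrl -big_distrr /= -cZ.
move: H1; set S1 := (\sum_z conv _ _)%N; set S0 := (\sum_z _)%N.
set Z := (q ^ P * q ^ P)%N; rewrite !expnS.
set y := (Y ^ m)%N; set zm := (Z ^ m)%N => H1 H2.
have := congr1 (muln y) H1.
move: (nat_of_bool _) => b; clearbody S1 S0 Y y Z zm; clear -H2; move: (#|_|) H2 => k H2 H3. lia.
Qed.

Lemma card_hypform_zeros (p m : nat) :
  (q ^ p.*2.+1 * conv (nseq m (@hypform F p.+1)) 0%R
     = \sum_(al : 'rV[F]_p.*2.+1)
         (q ^ p.+1 * #|annih (coefform al) p.+1 p.+1|) ^ m)%N.
Proof.
have q1 := finNzRing_gt1 F.
pose T : finType := ('rV[F]_p.+1 * 'rV[F]_p.+1)%type; set N := p.*2.+1.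
have nseqE (W : Type) (x : W) : nseq m x = [seq x | i <- enum 'I_m].
  by rewrite -[in LHS](size_enum_ord m); elim: (enum _) => //= _ s ->.
have cE (W : zmodType) (phi : T -> W) (w : W) :
    conv (nseq m phi) w = #|[set x : {ffun 'I_m -> T} | \sum_i phi (x i) == w]|.
  by rewrite nseqE -(card_sum_eq (fun=> phi)).
pose w (x : {ffun 'I_m -> T}) := \sum_i hypform (x i).
(* The products have degree at most [2p], so functionals on [p.*2.+1] coefficients see all of
   [w x]. *)
have sw x : (size (w x) <= N)%N.
  apply: leq_trans (size_sum _ _ _) _; apply/bigmax_leqP => i _.
  apply: leq_trans (size_polyMleq _ _) _.
  have := leq_add (size_rVpoly (x i).1) (size_rVpoly (x i).2).
  by rewrite addSn addnS addnn; case: (_ + size _)%N.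
have count2 : (\sum_(al : 'rV[F]_N) q * conv (nseq m (fun z : T => coefform al (hypform z))) 0%R
    = \sum_(x : {ffun 'I_m -> T}) (q ^ N + (w x == 0%R) * (q.-1 * q ^ N)))%N.
  rewrite -big_distrr /= (eq_bigr (fun al : 'rV[F]_N =>
    \sum_(x : {ffun 'I_m -> T}) (coefform al (w x) == 0%R : nat))%N).
    rewrite exchange_big big_distrr; apply: eq_bigr => x _.
    rewrite -card_coefform_eq0 //; congr muln.
    by rewrite -sum1dep_card [RHS]big_mkcond; apply: eq_bigr => al _; case: (_ == _).
  move=> al _; rewrite cE -sum1dep_card big_mkcond; apply: eq_bigr => x _.
  by rewrite linear_sum; case: (_ == _).
have sumw : (\sum_(x : {ffun 'I_m -> T}) (w x == 0%R) = conv (nseq m (@hypform F p.+1)) 0%R)%N.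
  by rewrite cE -sum1dep_card [RHS]big_mkcond; apply: eq_bigr => x _; case: (_ == _).
have cT : #|T| = (q ^ p.+1 * q ^ p.+1)%N by rewrite card_prod card_mx mul1n.
have count1 : (\sum_(al : 'rV[F]_N) (q * conv (nseq m (fun z : T => coefform al (hypform z))) 0%R
      + (q ^ p.+1 * #|annih (coefform al) p.+1 p.+1|) ^ m)
    = \sum_(al : 'rV[F]_N) (#|T| ^ m + q * (q ^ p.+1 * #|annih (coefform al) p.+1 p.+1|) ^ m))%N.
  apply: eq_bigr => al _.
  by have := conv_scalar_hypform p.+1 m (coefform al) 0; rewrite eqxx mul1n cT => ->.
move: count1; rewrite big_split /= count2 !big_split /= -big_distrl /= sumw.
rewrite !sum_nat_const card_ffun card_ord card_mx mul1n -big_distrr /=.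
set A := (\sum_al _)%N; set H := conv _ _ => E.
(* The generic terms of the two counts are both [q^N * #|T|^m] and cancel. *)
have : (q.-1 * (q ^ N * H) = q.-1 * A)%N.
  move: E q1; move: (_ ^ N)%N (_ ^ m)%N => x y; clearbody A H.
  by case: (q) => //= k E _; lia.
by move/eqP; rewrite eqn_pmul2l => [/eqP|]; rewrite // -subn1 subn_gt0.
Qed.

(** Exchange the sums: [u = 0] allows every functional, while for [u != 0] the [d] conditions are
    independent because multiplication by [u] is injective, leaving dimension [N - d = c - 1]. At
    [c = 0] the factor [(q ^ c).-1] vanishes. *)
Lemma sum_card_annih (N c d : nat) : (c + d)%N = N.+1 ->
  (\sum_(al : 'rV[F]_N) #|annih (coefform al) c d|
     = q ^ N + (q ^ c).-1 * q ^ c.-1)%N.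
Proof.
move=> cd.
have swap : (\sum_(al : 'rV[F]_N) #|annih (coefform al) c d|
    = \sum_(u : 'rV[F]_c) #|[set al : 'rV[F]_N | u \in annih (coefform al) c d]|)%N.
  under eq_bigr => al _ do rewrite -sum1_card big_mkcond.
  by rewrite exchange_big; apply: eq_bigr => u _; rewrite -sum1dep_card -big_mkcond.
rewrite {}swap (bigD1 0) //=; congr addn.
  have -> : (q ^ N = #|'rV[F]_N|)%N by rewrite card_mx mul1n.
  apply: eq_card => al; rewrite !inE.
  by apply/forallP => j; rewrite linear0 mul0r linear0.
rewrite (eq_bigr (fun=> q ^ c.-1)%N) => [|u u0].
  rewrite sum_nat_const; congr muln; rewrite -[c in RHS]mul1n -card_mx.
  by rewrite -(cardC1 (0 : 'rV[F]_c)); apply: eq_card => u; rewrite !inE.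
pose B : 'M[F]_(N, d) := \matrix_(k, j) (rVpoly u * 'X^j)`_k.
have BE (al : 'rV[F]_N) j : (al *m B) 0 j = coefform al (rVpoly u * 'X^j).
  by rewrite mxE; apply: eq_bigr => k _; rewrite mxE.
have ru0 : rVpoly u != 0 by apply: contraNneq u0 => ru; rewrite -(rVpolyK u) ru linear0.
(* A dependency [v] between the conditions kills the coefficients of [u v] below [N], and
   [c + d = N.+1] leaves no others. *)
have rB : \rank B = d.
  rewrite -mxrank_tr; apply/eqP; rewrite -[_ == _]/(row_free _) -kermx_eq0.
  apply/rowV0P => v /sub_kermxP vB.
  have : rVpoly u * rVpoly v = 0.
    have sz : (size (rVpoly u * rVpoly v)%R <= N)%N.
      apply: leq_trans (size_polyMleq _ _) _.
      have := leq_add (size_rVpoly u) (size_rVpoly v).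
      by rewrite cd; case: (_ + size _)%N.
    apply/polyP => k; rewrite coef0; case: (ltnP k N) => [kN|/(leq_trans sz)]; last first.
      by move/leq_sizeP->.
    move/rowP/(_ (Ordinal kN)): vB; rewrite !mxE => vB.
    rewrite -[RHS]vB [rVpoly v]rVpoly_sum mulr_sumr coef_sum.
    by apply: eq_bigr => j _; rewrite !mxE -scalerAr coefZ.
  move/eqP; rewrite mulf_eq0 (negPf ru0) /= => /eqP rv.
  by rewrite -(rVpolyK v) rv linear0.
have -> : c.-1 = \rank (kermx B) by rewrite mxrank_ker rB; lia.
rewrite -card_rowg; apply: eq_card => al; rewrite inE mem_rowg sub_kermx.
apply/annihP/eqP => [H|H j jd]; first by apply/rowP=> j; rewrite BE H ?mxE.
by rewrite -(BE al (Ordinal jd)) H mxE.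
Qed.

(** * Power sums of the nullities and the resulting zero counts *)

Local Notation N p := p.*2.+1.
Local Notation D p al c := (nullity (coefform al) c (p.*2.+2 - c)).

(* [x^D(c+1) - 1 = x (x^D(c) - 1) + (x - 1) [D(c+1) > 0]], by [nullity_pred]. *)
Lemma sum_exp_nullity (p c x : nat) : (c <= p)%N -> (0 < x)%N ->
  (\sum_(al : 'rV[F]_(N p)) x ^ D p al c.+1 + x * q ^ N p
   = x * (\sum_(al : 'rV[F]_(N p)) x ^ D p al c) + q ^ N p
     + x.-1 * \sum_(al : 'rV[F]_(N p)) (0 < D p al c.+1))%N.
Proof.
move=> cp x0; have -> : (q ^ N p = \sum_(al : 'rV[F]_(N p)) 1)%N.
  by rewrite sum1_card card_mx mul1n.
rewrite !big_distrr -!big_split /=; apply: eq_bigr => al _.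
rewrite (nullity_pred _ cp); case: (nullity _ _ _) => [|k] /=; first by lia.
by rewrite expnS; lia.
Qed.

(** At [x = q] both power sums are known from [sum_card_annih], so the recursion can be solved for
    this count. *)
Lemma sum_nullity_gt0 (p c : nat) : (c <= p)%N ->
  (\sum_(al : 'rV[F]_(N p)) (0 < D p al c.+1) = q ^ c * q ^ c)%N.
Proof.
move=> cp; have q1 := finNzRing_gt1 F.
have q0 : (0 < q)%N := ltnW q1.
have := sum_exp_nullity cp q0; under eq_bigr do rewrite -card_annih.
rewrite [in RHS](eq_bigr (fun al : 'rV[F]_(N p) => #|annih (coefform al) c (p.*2.+2 - c)|)).
  2: by move=> al _; rewrite -card_annih.
rewrite !sum_card_annih; try lia.
set n := (\sum_al _)%N => H.
have qc : (0 < q ^ c)%N by rewrite expn_gt0 q0.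
have E : (q * ((q ^ c).-1 * q ^ c.-1) = (q ^ c).-1 * q ^ c)%N.
  by case: (c) => [|k]; rewrite ?muln0 // mulnCA -expnS.
have : (q.-1 * n = q.-1 * (q ^ c * q ^ c))%N.
  move: H E q1 qc; rewrite (expnS q c) mulnDr; clearbody n.
  move: (q ^ N p)%N (q ^ c)%N (q ^ c.-1)%N => x y z.
  case: (q) => // k; case: y => // y H E _ _.
  move: H; rewrite E mulnC mulSn /=; lia.
by move/eqP; rewrite eqn_pmul2l => [/eqP|]; rewrite // -subn1 subn_gt0.
Qed.

(** Subtracting [q^N] makes [T] the sum of [x^D - 1], which starts from 0 at [k = 0]. *)
Lemma sum_exp_nullity_rat (p c x : nat) : (c <= p)%N -> (0 < x)%N ->
  let T k : rat := (\sum_(al : 'rV[F]_(N p)) x ^ D p al k)%N%:R - q%:R ^+ N p in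
  T c.+1 = x%:R * T c + (x%:R - 1) * q%:R ^+ (2 * c).
Proof.
move=> cp x0 T; have := congr1 (fun k => k%:R : rat) (sum_exp_nullity cp x0).
rewrite /T sum_nullity_gt0 // !(natrD, natrM) -subn1 natrB // !natrX mulnC exprM => H.
by rewrite -[X in X - _ = _](addrK (x%:R * q%:R ^+ N p)) H; ring.
Qed.

Lemma sum_exp_nullity0 (p x : nat) :
  (\sum_(al : 'rV[F]_(N p)) x ^ D p al 0)%N = (q ^ N p)%N.
Proof.
under eq_bigr do rewrite nullity0.
by rewrite sum1_card card_mx mul1n.
Qed.

Lemma card_hypform_zeros_exp (p m : nat) :
  (q ^ N p * conv (nseq m (@hypform F p.+1)) 0%R
     = (q ^ m) ^ p.+1 * \sum_(al : 'rV[F]_(N p)) (q ^ m) ^ D p al p.+1)%N.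
Proof.
rewrite card_hypform_zeros big_distrr; apply: eq_bigr => al _ /=.
have -> : (p.*2.+2 - p.+1 = p.+1)%N by lia.
by rewrite card_annih expnMn -!expnM ![(m * _)%N]mulnC.
Qed.

(** The multiplier [x = q^2] resonates with the source term [q^(2c)], which produces the factor
    P. *)
Lemma card_hypform_zeros2 (p : nat) :
  (conv (nseq 2 (@hypform F p.+1)) 0%R)%:R
    = (q%:R ^+ 2 - 1) / q%:R * p.+1%:R * q%:R ^+ (2 * p.+1) + q%:R ^+ (2 * p.+1) :> rat.
Proof.
have q0 : (0 < q)%N := ltnW (finNzRing_gt1 F).
have q0R : q%:R != 0 :> rat by rewrite pnatr_eq0 -lt0n.
have Q0 : (0 < q ^ 2)%N by rewrite expn_gt0 q0.
pose T k : rat := (\sum_(al : 'rV[F]_(N p)) (q ^ 2) ^ D p al k)%N%:R - q%:R ^+ N p.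
(* The factor [q^2] avoids the exponent [2c - 2], negative at [c = 0]. *)
have TE c : (c <= p.+1)%N ->
    q%:R ^+ 2 * T c = c%:R * (q%:R ^+ 2 - 1) * q%:R ^+ (2 * c).
  elim: c => [_|c IHc cp].
    by rewrite /T sum_exp_nullity0 natrX subrr mulr0 !mul0r.
  rewrite [T _](sum_exp_nullity_rat (cp : (c <= p)%N) Q0) -/(T c) natrX.
  rewrite mulrDr mulrCA (IHc (ltnW cp)) mulnS exprD -natr1; ring.
have := congr1 (fun k => k%:R : rat) (card_hypform_zeros_exp p 2).
rewrite !natrM -[X in _ = _ * X](subrK (q%:R ^+ N p)) -/(T _) => H.
have := TE p.+1 (leqnn _); move: H; rewrite !natrX -exprM (_ : q%:R ^+ N p = q%:R ^+ (2 * p.+1) / q%:R); last first.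
  by rewrite mulnS mul2n add2n [in RHS]exprSr mulfK.
move: (_ ^+ (2 * p.+1)) (expf_neq0 (2 * p.+1) q0R) (T _) => X X0 t.
move=> H Ht.
apply: (mulfI (mulf_neq0 X0 (invr_neq0 q0R))); rewrite H.
apply: (mulfI (expf_neq0 2 q0R)); rewrite mulrDr mulrDr mulrCA Ht; field; exact: q0R.
Qed.

(** Since [q^m] differs from [q^2], the recursion is solved by a difference of two geometric
    progressions. *)
Lemma card_hypform_zeros_ge3 (p m : nat) : (2 < m)%N ->
  (conv (nseq m (@hypform F p.+1)) 0%R)%:R
    = (q%:R ^+ m - 1) / (q%:R ^+ (m - 1) - q%:R) * q%:R ^+ (p.+1 * (m.*2 - 2))
      - (q%:R - 1) * (q%:R ^+ (m - 1) + 1) / (q%:R ^+ (m - 1) - q%:R)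
        * q%:R ^+ (m * p.+1) :> rat.
Proof.
move=> m2; have q1 := finNzRing_gt1 F; have q0 : (0 < q)%N := ltnW q1.
have q0R : q%:R != 0 :> rat by rewrite pnatr_eq0 -lt0n.
have Q0 : (0 < q ^ m)%N by rewrite expn_gt0 q0.
pose T k : rat := (\sum_(al : 'rV[F]_(N p)) (q ^ m) ^ D p al k)%N%:R - q%:R ^+ N p.
have TE c : (c <= p.+1)%N ->
    (q%:R ^+ m - q%:R ^+ 2) * T c
      = (q%:R ^+ m - 1) * ((q%:R ^+ m) ^+ c - q%:R ^+ (2 * c)).
  elim: c => [_|c IHc cp].
    by rewrite /T sum_exp_nullity0 natrX !subrr !mulr0.
  rewrite [T _](sum_exp_nullity_rat (cp : (c <= p)%N) Q0) -/(T c) natrX.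
  rewrite mulrDr mulrCA (IHc (ltnW cp)) mulnS exprD [_ ^+ c.+1]exprS.
  by move: (_ ^+ m) (_ ^+ c) (_ ^+ (2 * c)) => Q Qc qc; ring.
have M0 : q%:R ^+ (m - 1) - q%:R != 0 :> rat.
  rewrite subr_eq0 -natrX eqr_nat neq_ltn orbC -{1}(expn1 q) ltn_exp2l //; lia.
have := congr1 (fun k => k%:R : rat) (card_hypform_zeros_exp p m).
rewrite !natrM -[X in _ = _ * X](subrK (q%:R ^+ N p)) -/(T _) => H.
have := TE p.+1 (leqnn _); move: H; rewrite !natrX.
rewrite (_ : q%:R ^+ N p = q%:R ^+ (2 * p.+1) / q%:R); last first.
  by rewrite mulnS mul2n add2n [in RHS]exprSr mulfK.
(* All powers are rewritten through a few atoms that [field] can treat as independent. *)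
rewrite (_ : q%:R ^+ (p.+1 * (m.*2 - 2))
    = ((q%:R ^+ m) ^+ p.+1) ^+ 2 / q%:R ^+ (2 * p.+1)); last first.
  apply: (canRL (mulfK (expf_neq0 _ q0R))); rewrite -exprD -!exprM; congr (_ ^+ _).
  rewrite -mul2n; nia.
rewrite (exprM _ m) (_ : q%:R ^+ m = q%:R * q%:R ^+ (m - 1)); last first.
  by rewrite -exprS subn1 prednK // ltnW // ltnW.
move: (_ ^+ (2 * p.+1)) (expf_neq0 (2 * p.+1) q0R) (T _) => X X0 t.
move: (_ ^+ (m - 1)) M0 => M M0; move: (_ ^+ p.+1) => Y H Ht.
apply: (mulfI (mulf_neq0 X0 (invr_neq0 q0R))); rewrite H.
have M1 : q%:R * M - q%:R ^+ 2 != 0 by rewrite expr2 -mulrBr mulf_neq0.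
apply: (mulfI M1); rewrite mulrCA mulrDr Ht; field.
exact/and3P.
Qed.

End Counting.

(** * Transfer from coefficient functions to row vectors, and conclusion *)

Lemma Ncount_hypform (F : finFieldType) (m P : nat) (a : 'I_m.*2 -> F) (e : F) :
  odd #|F| -> (forall i, a i != 0) -> e != 0 ->
  e ^+ 2 = (-1) ^+ m * \prod_i a i ->
  Ncount a P = conv (nseq m (@hypform F P)) 0.
Proof.
move=> oF a0 e0 eE.
pose h (c : {ffun 'I_P -> F}) : 'rV[F]_P := \row_j c j.
have bh : bijective h.
  exists (fun v : 'rV_P => [ffun j => v 0 j]) => [c|v].
    by apply/ffunP => j; rewrite ffunE mxE.
  by apply/rowP => j; rewrite mxE ffunE.
have pE c : poly_of_coefs c = rVpoly (h c).
  by rewrite rVpoly_sum; apply: eq_bigr => j _; rewrite mxE.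
rewrite -(@conv_split_form F oF P [seq a i | i <- enum 'I_m.*2] m e) //.
- rewrite -(conv_comp _ _ bh) -2!map_comp.
  apply: etrans (card_sum_eq (fun i => sqform (a i) \o h) 0).
  apply: eq_card => x; rewrite !inE; congr (_ == 0).
  by apply: eq_bigr => i _; rewrite pE.
- by rewrite size_map size_enum_ord.
- by apply/allP => _ /mapP[i _ ->].
by rewrite big_map big_enum.
Qed.

Theorem theorem5p4 (F : finFieldType) (n : nat) (a : 'I_n -> F) (P : nat) :
  odd #|F| ->
  (4 <= n)%N -> ~~ odd n ->
  (forall i, a i != 0) ->
  (exists b : F, b != 0 /\ b ^+ 2 = (-1) ^+ (n./2) * \prod_(i < n) a i) ->
  (1 <= P)%N ->
  let q : rat := (#|F|)%:R in
  (n = 4%N ->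
     (Ncount a P)%:R = (q ^+ 2 - 1) / q * P%:R * q ^+ (2 * P) + q ^+ (2 * P))
  /\
  ((6 <= n)%N ->
     (Ncount a P)%:R =
       (q ^+ (n./2) - 1) / (q ^+ (n./2 - 1) - q) * q ^+ (P * (n - 2))
       - (q - 1) * (q ^+ (n./2 - 1) + 1) / (q ^+ (n./2 - 1) - q)
           * q ^+ (n./2 * P)).
Proof.
move=> oF n4 en a0 [e [e0 eE]] P1 q.
have [m nE] : exists m, n = m.*2 by exists n./2; rewrite even_halfK.
case: P P1 => // p _; subst n; rewrite doubleK in eE *.
rewrite (Ncount_hypform p.+1 oF a0 e0 eE); split=> [m2|m6].
  have -> : m = 2 by lia.
  exact: card_hypform_zeros2.
by apply: card_hypform_zeros_ge3; lia.
Qed.
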